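(* Let $r\ge1$ and let $k_1,\ldots,k_r$ be positive integers such that $k_i$ is even for all $1\le i\le r-1$ and $k_r$ is odd. Put $k=k_1+\cdots+k_r$. Then, in $\mathcal{A}$, $$\sum_{\sigma\in\Sigma_{r}}\left(r+1-2\sigma^{-1}(r)\right)\zeta_{\mathcal{A}}^{(2)}(k_{\sigma(1)},\dots,k_{\sigma(r)})=(-1)^{r}\sum_{\tau\in\Sigma_{r-1}}C(k_{\tau(1)},\ldots,k_{\tau(r-1)},k_{r})\cdot Z(k).$$
   Context: Let $\mathcal{A}=\left(\prod_{p}\mathbb{Z}/p\mathbb{Z}\right)/\left(\bigoplus_{p}\mathbb{Z}/p\mathbb{Z}\right)$, where $p$ runs over all prime numbers; it is a $\mathbb{Q}$-algebra. An element of $\mathcal{A}$ is represented by a family $(a_{(p)})_p$ with $a_{(p)}\in\mathbb{Z}/p\mathbb{Z}$ (finitely many components may be left undefined), and two families represent the same element iff they agree for all but finitely many $p$. For positive integers $k_1,\ldots,k_r$, define $\zeta_{\mathcal{A}}^{(2)}(k_1,\ldots,k_r)\in\mathcal{A}$ by $$\zeta_{\mathcal{A}}^{(2)}(k_1,\ldots,k_r)_{(p)}=\sum_{0<m_1<\cdots<m_r<p/2}\frac{1}{m_1^{k_1}\cdots m_r^{k_r}}\bmod p.$$ For an integer $k\ge2$, define $Z(k)\in\mathcal{A}$ by $Z(k)_{(p)}=\frac{B_{p-k}}{k}\bmod p$, where $B_n$ is the $n$th Bernoulli number. For positive integers $k_1,\ldots,k_r$ with sum $k$, put $$C(k_1,\ldots,k_r)=\sum_{j=1}^{r-1}(-1)^{k_1+\cdots+k_j}\binom{k}{k_1+\cdots+k_j}\in\mathbb{Z}.$$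 $\Sigma_n$ denotes the group of permutations of $\{1,\ldots,n\}$ ($\Sigma_0$ is trivial). When $r=1$, $C(k_1)=0$ is an empty sum, and the right-hand side of the identity is understood to be $0$ (including the case $k=1$, where $Z(1)$ is not defined). *)

(* Defs.v *)
From HB Require Import structures.
From mathcomp Require Import all_boot all_order all_algebra all_fingroup.
From mathcomp Require Import generic_quotient ring_quotient.
From mathcomp Require Import boolp classical_sets functions cardinality.

Set Implicit Arguments.
Unset Strict Implicit.
Unset Printing Implicit Defensive.

Import Order.TTheory GRing.Theory Num.Theory.

Local Open Scope ring_scope.
Local Open Scope quotient_scope.

Definition primeN : Type := {p : nat | prime p}.

Definition prodFp : Type := forall p : primeN, 'F_(val p).

HB.instance Definition _ := Choice.on prodFp.

Section ProdFpRing.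
Implicit Types a b c : prodFp.

Definition prodFp_zero : prodFp := fun _ => 0.
Definition prodFp_one : prodFp := fun _ => 1.
Definition prodFp_opp a : prodFp := fun p => - a p.
Definition prodFp_add a b : prodFp := fun p => a p + b p.
Definition prodFp_mul a b : prodFp := fun p => a p * b p.

Fact prodFp_addA : associative prodFp_add.
Proof. by move=> a b c; apply: functional_extensionality_dep => p; apply: addrA. Qed.
Fact prodFp_addC : commutative prodFp_add.
Proof. by move=> a b; apply: functional_extensionality_dep => p; apply: addrC. Qed.
Fact prodFp_add0 : left_id prodFp_zero prodFp_add.
Proof. by move=> a; apply: functional_extensionality_dep => p; apply: add0r. Qed.
Fact prodFp_addN : left_inverse prodFp_zero prodFp_opp prodFp_add.
Proof. by move=> a; apply: functional_extensionality_dep => p; apply: addNr. Qed.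

HB.instance Definition _ :=
  GRing.isZmodule.Build prodFp prodFp_addA prodFp_addC prodFp_add0 prodFp_addN.

Fact prodFp_mulA : associative prodFp_mul.
Proof. by move=> a b c; apply: functional_extensionality_dep => p; apply: mulrA. Qed.
Fact prodFp_mulC : commutative prodFp_mul.
Proof. by move=> a b; apply: functional_extensionality_dep => p; apply: mulrC. Qed.
Fact prodFp_mul1 : left_id prodFp_one prodFp_mul.
Proof. by move=> a; apply: functional_extensionality_dep => p; apply: mul1r. Qed.
Fact prodFp_mulD : left_distributive prodFp_mul +%R.
Proof. by move=> a b c; apply: functional_extensionality_dep => p; apply: mulrDl. Qed.
Fact prodFp_neq0 : prodFp_one != 0.
Proof.
apply/eqP => /(congr1 (fun a : prodFp => a (exist _ 2 isT))) /eqP.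
by rewrite /prodFp_one oner_eq0.
Qed.

HB.instance Definition _ := GRing.Zmodule_isComNzRing.Build prodFp
  prodFp_mulA prodFp_mulC prodFp_mul1 prodFp_mulD prodFp_neq0.

End ProdFpRing.

Definition sumFp (a : prodFp) : bool := `[< finite_set [set p | a p != 0]%classic >].

Fact infinite_primeN : ~ finite_set [set: primeN]%classic.
Proof.
move=> /finite_seqP[s sT].
pose q := \prod_(p <- s) val p.
have q_gt0 : (0 < q)%N by rewrite /q prodn_gt0 // => p; apply/prime_gt0/valP.
have [p p_gt pP] := prime_above q.
have ps : (exist _ p pP : primeN) \in s.
  by have : [set: primeN]%classic (exist _ p pP : primeN) by []; rewrite sT.
have : (p %| q)%N by rewrite /q (big_rem _ ps) dvdn_mulr.
by move=> /(dvdn_leq q_gt0); rewrite leqNgt p_gt.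
Qed.

Fact sumFp_idealr : idealr_closed (sumFp : {pred prodFp}).
Proof.
split=> [||a u v].
- apply/asboolP; rewrite (_ : mkset _ = set0) //.
  by apply/seteqP; split=> p //=; rewrite eqxx.
- apply/negP => /asboolP; rewrite (_ : mkset _ = setT); first exact: infinite_primeN.
  by apply/seteqP; split=> p //= _; apply: oner_neq0.
- move=> /asboolP fu /asboolP fv; apply/asboolP.
  have: finite_set ([set p | u p != 0] `|` [set p | v p != 0])%classic.
    by rewrite finite_setU.
  apply: sub_finite_set => p /= uv.
  have [u0|] := eqVneq (u p) 0; last by left.
  by right; apply: contra uv => /eqP v0; apply/eqP;
  rewrite [LHS](_ : _ = a p * u p + v p) // u0 v0 mulr0 addr0.
Qed.

HB.instance Definition _ := isIdealr.Build prodFp sumFp sumFp_idealr.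

Definition sumFp_ideal : idealr prodFp := sumFp.

Definition calA : comNzRingType := {ideal_quot sumFp_ideal}.

Definition toA (a : prodFp) : calA := \pi_({ideal_quot sumFp_ideal}) a.

Fact toA_eqP (a b : prodFp) :
  toA a = toA b <-> finite_set [set p | a p != b p]%classic.
Proof.
have -> : ([set p | a p != b p] = [set p | (a - b : prodFp) p != 0])%classic.
  by apply/seteqP; split=> p /=; rewrite -[(a - b) p]/(a p - b p) subr_eq0.
split=> [/eqP|ab]; first by rewrite -Quotient.idealrBE => /asboolP.
by apply/eqP; rewrite -Quotient.idealrBE; apply/asboolP.
Qed.

Definition zetaA2 (r : nat) (k : 'I_r -> nat) : calA :=
  toA (fun p : primeN =>
    \sum_(m : {ffun 'I_r -> 'I_(val p)} |
          [&& [forall i : 'I_r, 0 < m i]%N,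
              [forall i : 'I_r, forall j : 'I_r, (i < j)%N ==> (m i < m j)%N]
            & [forall i : 'I_r, 2 * m i < val p]%N])
      \prod_(i < r) (m i)%:R ^- k i).

Fixpoint bernoulli_seq (n : nat) : seq rat :=
  if n is n'.+1 then
    let s := bernoulli_seq n' in
    rcons s (- (n.+1%:R)^-1 * \sum_(j < n) 'C(n.+1, j)%:R * s`_j)
  else [:: 1].

Definition bernoulli (n : nat) : rat := (bernoulli_seq n)`_n.

Fact size_bernoulli_seq n : size (bernoulli_seq n) = n.+1.
Proof. by elim: n => //= n IHn; rewrite size_rcons IHn. Qed.

Fact nth_bernoulli_seq n j : (j <= n)%N -> (bernoulli_seq n)`_j = bernoulli j.
Proof.
elim: n => [|n IHn]; first by rewrite leqn0 => /eqP ->.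
rewrite leq_eqVlt => /orP[/eqP -> //|jn].
by rewrite /= nth_rcons size_bernoulli_seq jn IHn.
Qed.

Fact bernoulli0 : bernoulli 0 = 1. Proof. by []. Qed.

Fact bernoulli_sum n :
  (0 < n)%N -> \sum_(j < n.+1) 'C(n.+1, j)%:R * bernoulli j = 0.
Proof.
case: n => // n _; rewrite big_ord_recr /= binSn.
rewrite {2}/bernoulli /= nth_rcons size_bernoulli_seq ltnn eqxx.
rewrite mulNr mulrN mulVKf ?pnatr_eq0 //; apply/eqP; rewrite subr_eq0; apply/eqP.
by apply: eq_bigr => j _; rewrite nth_bernoulli_seq // -ltnS.
Qed.

(* [ratr] reduces a rational number modulo p (numerator over denominator); by
   von Staudt-Clausen, p does not divide the denominator of B_(p-k) when
   2 <= k < p.  The finitely many components with p <= k are irrelevant in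
   [calA].  Only k >= 2 is meaningful. *)
Definition ZA (k : nat) : calA :=
  toA (fun p : primeN => ratr (bernoulli (val p - k) / k%:R)).

(* With the indices shifted to 0, ..., r-1, the partial sum k_1 + ... + k_j is
   the sum of the [k i] with [i < j]. *)
Definition Ccoef (r : nat) (k : 'I_r -> nat) : int :=
  \sum_(1 <= j < r)
    (-1) ^+ (\sum_(i < r | (i < j)%N) k i)%N
    * 'C(\sum_(i < r) k i, \sum_(i < r | (i < j)%N) k i)%N%:Z.

(* Main.v *)
Require Import Defs.
From mathcomp Require Import all_boot all_order all_algebra all_fingroup all_field.
From mathcomp Require classical_sets cardinality.
From mathcomp Require Import zify ring.
Set Implicit Arguments.
Unset Strict Implicit.
Unset Printing Implicit Defensive.
Import GRing.Theory Num.Theory.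
Local Open Scope ring_scope.

(** Fix a prime p > k + 1 and let H be the set of the m with 0 < m < p/2.
    Sorting turns a pair (a permutation, an increasing tuple) into an arbitrary
    tuple (a_1, ..., a_r) of distinct elements of H, and sigma^-1(r) becomes the
    rank of a_r among the a_i.  The weight r + 1 - 2 sigma^-1(r) counts the a_i
    above a_r minus the a_i below a_r, so the left-hand side is
      sum over distinct tuples of
        a_1^-k_1 ... a_r^-k_r * sum_(i < r) sgn(a_i - a_r)
    ([sum_perm_zeta_half]).

    For an even exponent e with 0 < e < p - 1 the sum of x^-e over H vanishes:
    it is half of a power sum over all nonzero residues.  Hence, when a_i = x and
    a_r = y are fixed, summing over the other entries, which have even
    exponents and must only avoid each other, x and y, amounts to merging
    each of them with x or with y.  With formal variables t_j of square zero and
    F(z) = sum_j t_j z^-k_j, the product of the 1 + F(z) over z in H is 1, so its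
    part over H minus {x, y} is 1/((1 + F(x))(1 + F(y))), whose coefficients are
    signed products of two factorials ([dsum_minus2]).  The left-hand side is thus
      (-1)^r sum_S |S|! (r - 1 - |S|)! T(k_S, k - k_S)
    over the nonempty subsets S of {1, ..., r - 1}, where k_S is the sum of the k_i
    with i in S and T(e, o) = sum_(x, y in H) sgn(x - y) x^-e y^-o
    ([sum_pinj_pairs]).  The same factorials count the permutations tau such
    that tau({1, ..., j}) = S, so they also appear on the right-hand side
    ([sum_Ccoef]), and it remains to see that T(e, o) = C(e + o, e) Z(e + o) for
    e even and o odd ([sum_sgn_half]).

    Let A(y) be the sum of the x^-e over 0 < x < y.  The reflection y -> p - y
    identifies T(e, o) with minus the sum of y^-o A(y) over all nonzero residues.
    As x^-e = x^(p-1-e), Faulhaber's formula writes A(y) as a polynomial with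
    Bernoulli numbers as coefficients; among the power sums so obtained, the only
    one that does not vanish goes with B_(p-k) ([sum_power_psum]). *)

(** * Power sums over the prime field *)

Lemma sum_nat_Fp (p : nat) (V : nmodType) (G : 'F_p -> V) : prime p ->
  \sum_(0 <= y < p) G y%:R = \sum_(x : 'F_p) G x.
Proof.
move=> pr; rewrite -{1}(Fp_cast pr) big_mkord.
by apply: eq_bigr => x _; congr G; rewrite -[RHS]natr_Zp.
Qed.

Lemma natr_Fp_neq0 (p i : nat) : prime p -> (0 < i < p)%N -> i%:R != 0 :> 'F_p.
Proof.
move=> pr /andP[i0 ip]; rewrite -(dvdn_pcharf (pchar_Fp pr)).
by apply/negP => /(dvdn_leq i0); lia.
Qed.

Lemma expf_Fp_predp (p : nat) (x : 'F_p) : prime p -> x != 0 -> x ^+ p.-1 = 1.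
Proof.
move=> pr x0; apply: (mulfI x0); rewrite -exprS prednK ?prime_gt0 // mulr1.
by have := expf_card x; rewrite card_Fp.
Qed.

(** If x^N is not always 1 on nonzero x, pick g with g^N <> 1: multiplication by g
    permutes the field, and the sum is invariant under multiplication by g^N. *)
Lemma sum_expr_Fp (p N : nat) : prime p -> (0 < N)%N ->
  \sum_(x : 'F_p) x ^+ N = - (p.-1 %| N)%:R.
Proof.
move=> pr N0; have p1 := prime_gt1 pr.
case: (boolP (p.-1 %| N)%N) => [/dvdnP[q Nq]|nd].
  rewrite (bigD1 0) //= expr0n (gtn_eqF N0) add0r.
  rewrite (eq_bigr (fun=> 1)); last first.
    by move=> x x0; rewrite Nq mulnC exprM expf_Fp_predp // expr1n.
  rewrite sumr_const cardC1 card_Fp //.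
  apply/eqP; rewrite -addr_eq0 -mulrSr prednK ?prime_gt0 //.
  exact/eqP/(pcharf0 (pchar_Fp pr)).
pose d := (N %% p.-1)%N.
have d0 : (0 < d)%N by rewrite lt0n.
have dp : (d < p.-1)%N by rewrite ltn_mod; lia.
(* Otherwise X^d - 1, of degree d < p - 1, would have p - 1 roots. *)
have [g g0 gd] : exists2 g : 'F_p, g != 0 & g ^+ N != 1.
  apply/exists_inP; apply: contraT => /exists_inPn all1.
  have nz : 'X^d - 1 != 0 :> {poly 'F_p}.
    by rewrite -size_poly_eq0 size_XnsubC.
  have := max_poly_roots nz _ (enum_uniq (predC1 (0 : 'F_p))).
  rewrite size_XnsubC // -cardE cardC1 card_Fp // => /(_ _) H.
  have /H : all (root ('X^d - 1)) (enum (predC1 (0 : 'F_p))).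
    apply/allP => x; rewrite mem_enum => x0.
    have := all1 x x0; rewrite negbK {1}(divn_eq N p.-1) exprD mulnC exprM.
    rewrite expf_Fp_predp // expr1n mul1r => /eqP xd.
    by rewrite rootE !hornerE xd subrr.
  by lia.
have : (g ^+ N - 1) * \sum_(x : 'F_p) x ^+ N = 0.
  rewrite mulrBl mul1r mulr_sumr.
  rewrite [X in _ - X](reindex_inj (mulfI g0)).
  by apply/eqP; rewrite subr_eq0; apply/eqP/eq_bigr => x _; rewrite exprMn.
move/eqP; rewrite mulf_eq0 subr_eq0 (negPf gd) /= => /eqP->.
by rewrite oppr0.
Qed.

(** * Faulhaber's formula modulo p *)

Lemma ffactnD (N i j : nat) : (N ^_ (i + j) = N ^_ i * (N - i) ^_ j)%N.
Proof.
elim: j => [|j IH]; first by rewrite addn0 ffactn0 muln1.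
by rewrite addnS !ffactnSr IH mulnA subnDA.
Qed.

Lemma mul_bin_swap (N i j : nat) :
  ('C(N, i) * 'C(N - i, j) = 'C(N, j) * 'C(N - j, i))%N.
Proof.
have E a b : ('C(N, a) * 'C(N - a, b) * (a`! * b`!) = N ^_ (a + b))%N.
  by rewrite ffactnD -!bin_ffact mulnACA.
have f0 : (0 < i`! * j`!)%N by rewrite muln_gt0 !fact_gt0.
by apply/eqP; rewrite -(eqn_pmul2r f0) E mulnC [(i`! * _)%N]mulnC mulnC E addnC.
Qed.

(** Induction on y.  Expanding (y + 1)^(m+1-j) and using
    C(m+1,j) C(m+1-j,i) = C(m+1,i) C(m+1-i,j), the recursion of the b_j kills every
    y^i with i < m.  Only the recursion up to m is assumed, since modulo p the
    Bernoulli numbers satisfy it for finitely many indices. *)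
Lemma faulhaber (R : comNzRingType) (b : nat -> R) (m : nat) : b 0 = 1 ->
  (forall i, (0 < i <= m)%N -> \sum_(j < i.+1) 'C(i.+1, j)%:R * b j = 0) ->
  forall y, m.+1%:R * \sum_(0 <= x < y) x%:R ^+ m
    = \sum_(j < m.+1) 'C(m.+1, j)%:R * b j * y%:R ^+ (m.+1 - j).
Proof.
move=> b0 brec; elim=> [|y IH].
  rewrite big_geq // mulr0 big1 // => j _.
  by rewrite expr0n subn_eq0 leqNgt ltn_ord mulr0.
rewrite big_nat_recr //= mulrDr IH.
(* The range of i is widened to m + 1 to make it independent of j. *)
have expand (j : 'I_m.+1) : y.+1%:R ^+ (m.+1 - j) = y%:R ^+ (m.+1 - j)
    + \sum_(i < m.+1 | (i < m.+1 - j)%N) 'C(m.+1 - j, i)%:R * y%:R ^+ i :> R.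
  rewrite -(big_ord_widen_cond _ xpredT (fun i => 'C(m.+1 - j, i)%:R * y%:R ^+ i)) ?leq_subr //.
  rewrite -natr1 addrC exprDn big_ord_recr /= subnn expr0 mul1r binn mulr1n addrC.
  by congr (_ + _); apply: eq_bigr => i _; rewrite expr1n mul1r mulr_natl.
under [RHS]eq_bigr do rewrite expand mulrDr.
rewrite big_split /=; congr (_ + _).
under [RHS]eq_bigr do rewrite mulr_sumr.
rewrite (exchange_big_dep xpredT) //=.
rewrite big_ord_recr /= [X in _ = X + _]big1 ?add0r; last first.
  move=> i _.
  transitivity ('C(m.+1, i)%:R * y%:R ^+ i * (\sum_(j < m.+1 - i) 'C(m.+1 - i, j)%:R * b j)).
    rewrite (big_ord_widen_cond m.+1 xpredT (fun j => 'C(m.+1 - i, j)%:R * b j)) ?leq_subr //.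
    rewrite mulr_sumr; apply: eq_big => [j|j ij]; first by rewrite /=; lia.
    have /(congr1 (fun n => n%:R : R)) := mul_bin_swap m.+1 i j.
    rewrite !natrM => E; rewrite mulrAC [RHS]mulrA [_ * y%:R ^+ i * _]mulrAC E.
    by ring.
  have -> : (m.+1 - i = (m - i).+1)%N by have := ltn_ord i; lia.
  by rewrite brec ?mulr0 //; have := ltn_ord i; lia.
rewrite (bigD1 ord0) //= big1 ?addr0; last by move=> j; rewrite -val_eqE /=; lia.
by rewrite subn0 bin0 b0 !mul1r binSn mulr_natl.
Qed.

(** [ratr] is not a morphism in positive characteristic, as it is meaningless on
    fractions whose denominator vanishes.  This relation holds when x has some
    (not necessarily reduced) denominator that is a unit in F, which makes it
    compatible with the ring operations. *)
Definition reduces (F : fieldType) (x : rat) (c : F) : Prop :=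
  exists a b : int, [/\ b%:~R != 0 :> F, x = a%:~R / b%:~R & c = a%:~R / b%:~R].

Lemma intr_neq0 (F : fieldType) (b : int) : b%:~R != 0 :> F -> b%:~R != 0 :> rat.
Proof. by rewrite intr_eq0; apply: contraNneq => ->; rewrite rmorph0. Qed.

(** The reduced denominator divides b, so it is invertible in F as well. *)
Lemma reduces_ratr (F : fieldType) (x : rat) (c : F) : reduces x c -> ratr x = c.
Proof.
case=> a [b [bF xE ->]]; have bQ := intr_neq0 bF.
have E : numq x * b = a * denq x.
  apply: (@intr_inj rat); rewrite !intrM numqE [X in X * _ * _]xE.
  by rewrite mulrAC divfK.
have dF : (denq x)%:~R != 0 :> F.
  have /dvdzP[q bE] : (denq x %| b)%Z.
    rewrite -(@Gauss_dvdzr _ (numq x)); last first.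
      by rewrite coprimezE coprime_sym; exact: coprime_num_den.
    by rewrite E dvdz_mull.
  by apply: contraNneq bF => d0; rewrite bE intrM d0 mulr0.
rewrite /ratr; apply/eqP; rewrite eqr_div //.
by rewrite -!intrM E.
Qed.

Lemma reduces_nat (F : fieldType) (m : nat) : reduces m%:R (m%:R : F).
Proof. by exists m%:Z, 1; rewrite rmorph1 oner_eq0 !divr1. Qed.

Lemma reducesD (F : fieldType) (x y : rat) (c d : F) :
  reduces x c -> reduces y d -> reduces (x + y) (c + d).
Proof.
move=> [a [b [b0 -> ->]]] [a' [b' [b'0 -> ->]]].
exists (a * b' + a' * b), (b * b'); rewrite !rmorphD !rmorphM /=.
by rewrite mulf_neq0 // !addf_div // ?(intr_neq0 b0) ?(intr_neq0 b'0).
Qed.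

Lemma reducesM (F : fieldType) (x y : rat) (c d : F) :
  reduces x c -> reduces y d -> reduces (x * y) (c * d).
Proof.
move=> [a [b [b0 -> ->]]] [a' [b' [b'0 -> ->]]].
exists (a * a'), (b * b'); rewrite !rmorphM /=.
by rewrite mulf_neq0 // !mulf_div.
Qed.

Lemma reducesN (F : fieldType) (x : rat) (c : F) : reduces x c -> reduces (- x) (- c).
Proof.
by move=> [a [b [b0 -> ->]]]; exists (- a), b; rewrite !rmorphN /= !mulNr.
Qed.

Lemma reducesV (F : fieldType) (m : nat) : m%:R != 0 :> F ->
  reduces (m%:R)^-1 ((m%:R)^-1 : F).
Proof. by exists 1, m%:Z; rewrite rmorph1 !div1r. Qed.

Lemma reduces_sum (F : fieldType) n (x : 'I_n -> rat) (c : 'I_n -> F) :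
  (forall i, reduces (x i) (c i)) -> reduces (\sum_i x i) (\sum_i c i).
Proof.
move=> h; apply: (big_ind2 (@reduces F)) => // [|*]; last exact: reducesD.
exact: (reduces_nat F 0).
Qed.

(** The elementary part of von Staudt-Clausen: the recursion for B_j divides by
    integers that are at most j + 1 < p. *)
Lemma reduces_bernoulli (p j : nat) : prime p -> (j < p.-1)%N ->
  reduces (bernoulli j) (ratr (bernoulli j) : 'F_p).
Proof.
move=> pr jp; suff [c h] : exists c : 'F_p, reduces (bernoulli j) c.
  by rewrite (reduces_ratr h).
elim/ltn_ind: j jp => -[|j] IH jp.
  by exists 1; rewrite bernoulli0; apply: (reduces_nat _ 1).
have IH' (i : 'I_j.+1) : reduces (bernoulli i) (ratr (bernoulli i) : 'F_p).
  have [|c h] := IH i (ltn_ord i); first by have := ltn_ord i; lia.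
  by rewrite (reduces_ratr h).
have := bernoulli_sum (ltn0Sn j).
rewrite big_ord_recr /= binSn => /eqP; rewrite addrC addr_eq0 => /eqP E.
have j0 : j.+2%:R != 0 :> 'F_p by apply: natr_Fp_neq0 => //; lia.
exists ((j.+2%:R)^-1 * - \sum_(i < j.+1) 'C(j.+2, i)%:R * ratr (bernoulli i)).
have -> : bernoulli j.+1
    = (j.+2%:R)^-1 * - \sum_(i < j.+1) 'C(j.+2, i)%:R * bernoulli i.
  by rewrite -E mulKf // pnatr_eq0.
apply: reducesM; first exact: reducesV.
apply: reducesN; apply: reduces_sum => i; apply: reducesM => //.
exact: reduces_nat.
Qed.

Lemma bernoulli_sum_Fp (p n : nat) : prime p -> (0 < n < p.-1)%N ->
  \sum_(j < n.+1) 'C(n.+1, j)%:R * ratr (bernoulli j) = 0 :> 'F_p.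
Proof.
move=> pr /andP[n0 np].
have : reduces (\sum_(j < n.+1) 'C(n.+1, j)%:R * bernoulli j)
   (\sum_(j < n.+1) 'C(n.+1, j)%:R * ratr (bernoulli j) : 'F_p).
  apply: reduces_sum => j; apply: reducesM; first exact: reduces_nat.
  by apply: reduces_bernoulli => //; have := ltn_ord j; lia.
by move/reduces_ratr <-; rewrite bernoulli_sum // ; apply/reduces_ratr/(reduces_nat _ 0).
Qed.

Lemma faulhaber_Fp (p m y : nat) : prime p -> (m < p.-1)%N ->
  m.+1%:R * \sum_(0 <= x < y) x%:R ^+ m
  = \sum_(j < m.+1) 'C(m.+1, j)%:R * ratr (bernoulli j) * y%:R ^+ (m.+1 - j) :> 'F_p.
Proof.
move=> pr mp; apply: (@faulhaber _ (fun j => ratr (bernoulli j))).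
  by rewrite bernoulli0; apply/reduces_ratr/(reduces_nat _ 1).
by move=> i im; apply: bernoulli_sum_Fp => //; lia.
Qed.

(** * Double power sums over the half interval *)

Lemma natr_Fp_fact_neq0 (p o : nat) : prime p -> (o < p)%N -> o`!%:R != 0 :> 'F_p.
Proof.
move=> pr; elim: o => [|o IH] lt; first exact: oner_neq0.
by rewrite factS natrM mulf_neq0 //; [exact: natr_Fp_neq0 | apply/IH/ltnW].
Qed.

Lemma natrB_Fp (p i : nat) : prime p -> (i <= p)%N -> (p - i)%:R = - i%:R :> 'F_p.
Proof. by move=> pr ip; rewrite natrB // pchar_Fp_0 // sub0r. Qed.

Lemma ffact_pred_mod (p e o : nat) : prime p -> (e + o <= p)%N ->
  (e + o)%:R * ((p - e) ^_ o)%:R = (-1) ^+ o * (e%:R * ((e + o) ^_ o)%:R) :> 'F_p.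
Proof.
move=> pr; elim: o => [|o IH] lt.
  by rewrite !ffactn0 addn0 expr0 mul1r.
rewrite addnS ffactSS ffactnSr !natrM -subnDA natrB_Fp //; last by lia.
rewrite exprS !mulN1r !mulrN mulNr; congr (- _).
by rewrite [_ * (e + o)%:R]mulrC IH; [ring | lia].
Qed.

(** In terms of falling factorials: modulo p, the factors p - e - i become
    -(e + i), an odd number of sign changes. *)
Lemma bin_pred_mod (p e o : nat) : prime p -> odd o -> (e + o < p)%N ->
  (e + o)%:R * 'C(p - e, o)%:R = - (e%:R * 'C(e + o, e)%:R) :> 'F_p.
Proof.
move=> pr oo lt.
have fo : o`!%:R != 0 :> 'F_p by apply: natr_Fp_fact_neq0 => //; lia.
apply: (mulIf fo); rewrite -mulrA -[in LHS]natrM bin_ffact ffact_pred_mod //; last by lia.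
have -> : 'C(e + o, e) = 'C(e + o, o) by rewrite -bin_sub ?leq_addr // addKn.
rewrite -signr_odd oo expr1 mulN1r.
rewrite mulNr; congr (- _); rewrite -bin_ffact natrM; ring.
Qed.

Lemma sum_fold_half (V : nmodType) (p : nat) (G : nat -> V) : odd p ->
  \sum_(1 <= y < p) G y = \sum_(1 <= y < p./2.+1) (G y + G (p - y)%N).
Proof.
move=> op; rewrite big_split /= (big_cat_nat (n := p./2.+1)) /=; try by lia.
congr (_ + _); rewrite [RHS]big_nat_rev /=.
rewrite -(add0n p./2.+1) big_addn -[in RHS](add0n 1%N) big_addn.
have -> : (p - p./2.+1 = p./2.+1 - 1)%N by lia.
by apply: eq_big_nat => i ip; congr G; lia.
Qed.

Lemma expVf_Fp (p e y : nat) : prime p -> (0 < y < p)%N -> (e <= p.-1)%N ->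
  y%:R ^- e = y%:R ^+ (p.-1 - e) :> 'F_p.
Proof.
move=> pr yp ep; have y0 := natr_Fp_neq0 pr yp.
by rewrite expfB_cond ?(negPf y0) // expf_Fp_predp // mul1r.
Qed.

Lemma sum_nat_expr (p N : nat) : prime p -> (0 < N)%N ->
  \sum_(1 <= y < p) y%:R ^+ N = - (p.-1 %| N)%:R :> 'F_p.
Proof.
move=> pr N0; rewrite -sum_expr_Fp // -(sum_nat_Fp _ pr).
by rewrite [RHS]big_ltn ?prime_gt0 // expr0n (gtn_eqF N0) add0r.
Qed.

(** An even power takes the same value at y and p - y, so twice this sum is a full
    power sum. *)
Lemma sum_half_even (p e : nat) : prime p -> odd p -> ~~ odd e -> (0 < e < p.-1)%N ->
  \sum_(1 <= y < p./2.+1) y%:R ^- e = 0 :> 'F_p.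
Proof.
move=> pr op ee lt.
have two : 2%:R != 0 :> 'F_p by apply: natr_Fp_neq0 => //; have := prime_gt1 pr; lia.
apply: (mulfI two); rewrite mulr0.
transitivity (\sum_(1 <= y < p) y%:R ^- e : 'F_p).
  rewrite [RHS]sum_fold_half // mulr_sumr; apply: eq_big_nat => y yp.
  by rewrite natrB_Fp //; [rewrite exprNn -signr_odd (negPf ee) mul1r mulrDl mul1r | lia].
rewrite (eq_big_nat _ _ (F2 := fun y => y%:R ^+ (p.-1 - e))); last first.
  by move=> y yp; rewrite expVf_Fp //; lia.
rewrite sum_nat_expr //; last by lia.
rewrite gtnNdvd ?oppr0 //; lia.
Qed.

(** Writing y^-o = y^(p-1-o), Faulhaber's formula gives power sums of exponent
    2p - 1 - (e + o) - j; this is a multiple of p - 1 only for j = p - (e + o). *)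
Lemma sum_power_psum (p e o : nat) : prime p -> odd o -> (0 < e)%N ->
  (e + o < p.-1)%N ->
  \sum_(1 <= y < p) y%:R ^- o * (\sum_(1 <= x < y) x%:R ^- e)
  = - ('C(e + o, e)%:R * (ratr (bernoulli (p - (e + o))) / (e + o)%:R)) :> 'F_p.
Proof.
move=> pr oo e0 lt.
set m := (p.-1 - e)%N; set b := ratr _.
have mE : m.+1 = (p - e)%N by rewrite /m; lia.
set S := LHS.
have e_neq0 : e%:R != 0 :> 'F_p by apply: natr_Fp_neq0 => //; lia.
have k_neq0 : (e + o)%:R != 0 :> 'F_p by apply: natr_Fp_neq0 => //; lia.
(* As m + 1 = p - e is -e modulo p, [bin_pred_mod] concludes from there. *)
suff HS : m.+1%:R * S = - ('C(p - e, o)%:R * b).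
  move: HS; rewrite mE natrB_Fp //; last by lia.
  rewrite mulNr => /oppr_inj HS.
  apply: (mulfI (mulf_neq0 e_neq0 k_neq0)).
  rewrite mulrAC HS mulrAC ['C(_, o)%:R * _]mulrC bin_pred_mod //; last by lia.
  by field; rewrite -natrD.
have jP : (p - (e + o) < m.+1)%N by lia.
transitivity (\sum_(j < m.+1) 'C(m.+1, j)%:R * ratr (bernoulli j)
    * (\sum_(1 <= y < p) y%:R ^+ (p.-1 - o + (m.+1 - j))) : 'F_p).
  rewrite mulr_sumr.
  under [RHS]eq_bigr do rewrite mulr_sumr.
  rewrite exchange_big /=; apply: eq_big_nat => y yp.
  rewrite mulrCA.
  transitivity (y%:R ^+ (p.-1 - o) * (m.+1%:R * \sum_(0 <= x < y) x%:R ^+ m) : 'F_p).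
    rewrite -expVf_Fp //; last by lia.
    rewrite [in RHS]big_ltn; last by lia.
    rewrite expr0n (_ : (m == 0)%N = false) ?add0r; last by rewrite /m; lia.
    by congr (_ * (_ * _)); apply: eq_big_nat => x xy; rewrite expVf_Fp //; lia.
  rewrite faulhaber_Fp //; last by rewrite /m; lia.
  rewrite mulr_sumr; apply: eq_bigr => j _.
  by rewrite exprD mulrCA.
rewrite (bigD1 (Ordinal jP)) //= [X in _ + X = _]big1 ?addr0; last first.
  move=> j; rewrite -val_eqE /= => jn.
  rewrite sum_nat_expr //; last by have := ltn_ord j; lia.
  rewrite (_ : (_ %| _)%N = false) ?oppr0 ?mulr0 //.
  apply/negP => /dvdnP[q Eq]; have := ltn_ord j.
  have : (q < 2)%N by rewrite ltnNge; apply/negP => q2; have := leq_mul2r p.-1 2 q; lia.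
  by case: q Eq => [|[|//]]; lia.
rewrite sum_nat_expr //; last by lia.
rewrite (_ : (p.-1 - o + (m.+1 - (p - (e + o))) = p.-1)%N) ?dvdnn; last by lia.
rewrite mulrN1; congr (- (_ * _)); rewrite mE; congr (_%:R).
by rewrite -bin_sub; [congr 'C(_, _) | ]; lia.
Qed.

(** With A(y) the sum of x^-e for 0 < x < y, the inner sum is -(2 A(y) + y^-e)
    because the total over the half interval vanishes.  As A(p) = 0,
    A(p - y) = -(A(y) + y^-e), so the left-hand side is the folded form of the full
    sum in [sum_power_psum]. *)
Lemma sum_sgn_half (p e o : nat) : prime p -> odd p -> ~~ odd e -> odd o ->
    (0 < e)%N -> (e + o < p.-1)%N ->
  \sum_(1 <= y < p./2.+1) \sum_(1 <= x < p./2.+1)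
     ((y < x)%:R - (x < y)%:R) * x%:R ^- e * y%:R ^- o
  = 'C(e + o, e)%:R * (ratr (bernoulli (p - (e + o))) / (e + o)%:R) :> 'F_p.
Proof.
move=> pr op ee oo e0 lt.
(* The sum over all nonzero residues is folded at p/2 and compared term by term. *)
apply: oppr_inj; rewrite -sum_power_psum // [RHS]sum_fold_half // -sumrN.
pose A y : 'F_p := \sum_(1 <= x < y) x%:R ^- e.
have A0 : A p = 0.
  rewrite /A (eq_big_nat _ _ (F2 := fun y => y%:R ^+ (p.-1 - e))); last first.
    by move=> y yp; rewrite expVf_Fp //; lia.
  rewrite sum_nat_expr //; last by lia.
  rewrite gtnNdvd ?oppr0 //; lia.
apply: eq_big_nat => y yp; rewrite -/(A y) -/(A (p - y)%N).
have -> : A (p - y)%N = - (A y + y%:R ^- e).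
  apply/eqP; rewrite -addr_eq0 -A0 [X in _ == X]/A (big_cat_nat (n := (p - y)%N)) /=; try by lia.
  apply/eqP; congr (_ + _); rewrite /A.
  rewrite [RHS]big_nat_rev /= -(add0n (p - y)%N) big_addn.
  rewrite -(big_nat_recr _ _ (fun x => x%:R ^- e)) /=; last by lia.
  rewrite -(add0n 1%N) big_addn.
  rewrite (_ : (p - (p - y) = y.+1 - 1)%N); last by lia.
  apply: eq_big_nat => x xy.
  rewrite (_ : (_ - _.+1)%N = p - (x + 1))%N; last by lia.
  by rewrite natrB_Fp //; [rewrite exprNn -signr_odd (negPf ee) mul1r | lia].
rewrite natrB_Fp //; last by lia.
rewrite exprNn -signr_odd oo expr1 mulN1r invrN.
rewrite -mulr_suml.
set D : 'F_p := \sum_(1 <= x < p./2.+1) _.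
suff -> : D = - (A y + (A y + y%:R ^- e)) by ring.
rewrite {}/D.
have H0 := sum_half_even pr op ee (_ : 0 < e < p.-1)%N.
have {H0} /eqP : (\sum_(1 <= x < p./2.+1) x%:R ^- e = 0 :> 'F_p) by apply: H0; lia.
have split_y (G : nat -> 'F_p) : \sum_(1 <= x < p./2.+1) G x
    = \sum_(1 <= x < y) G x + (G y + \sum_(y.+1 <= x < p./2.+1) G x).
  by rewrite (big_cat_nat (n := y)) ?(big_ltn (m := y)) //=; lia.
rewrite !split_y.
rewrite -/(A y) ltnn subrr mul0r add0r.
set B := \sum_(_ <= x < _) x%:R ^- e.
have -> : \sum_(1 <= x < y) ((y < x)%:R - (x < y)%:R) * x%:R ^- e = - A y.
  rewrite /A -sumrN; apply: eq_big_nat => x xy.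
  by have /andP[_ lt_xy] := xy; rewrite lt_xy ltnNge ltnW // sub0r mulN1r.
have -> : \sum_(y.+1 <= x < p./2.+1) ((y < x)%:R - (x < y)%:R) * x%:R ^- e = B.
  apply: eq_big_nat => x xy.
  by have /andP[lt_yx _] := xy; rewrite lt_yx ltnNge ltnW // subr0 mul1r.
rewrite addrA addr_eq0 => /eqP AE.
by rewrite AE opprD opprK.
Qed.

(** * Sums over partial injections *)

(** Injections from J to X.  They are extended by the constant t0 outside J, so that
    each is represented by exactly one total function and removing a point of J
    stays within the same type. *)
Definition pinj (I T : finType) (t0 : T) (X : {set T}) (J : {set I}) :
    pred {ffun I -> T} :=
  [pred a : {ffun I -> T} |
    [forall i, if i \in J then a i \in X else a i == t0] && dinjectiveb a J].

Definition upd (I T : finType) (a : {ffun I -> T}) (i : I) (x : T) : {ffun I -> T} :=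
  [ffun j => if j == i then x else a j].

Lemma pinj_upd (I T : finType) (t0 : T) (X : {set T}) (J : {set I}) i x (b : {ffun I -> T}) :
  i \in J -> x \in X ->
  pinj t0 X J (upd b i x) && (b i == t0) = pinj t0 (X :\ x) (J :\ i) b.
Proof.
move=> iJ xX; apply/idP/idP.
  case/andP=> /andP[/forallP h /dinjectiveP inj] /eqP bi.
  apply/andP; split.
    apply/forallP => j; have := h j; rewrite !inE ffunE.
    have [->|ji] /= := eqVneq j i; first by rewrite bi eqxx.
    case: ifP => // jJ ->; rewrite andbT.
    apply: contraNneq ji => bj; apply/eqP/inj => //.
    by rewrite !ffunE eqxx; case: eqP.
  apply/dinjectiveP => j l; rewrite !inE => /andP[ji jJ] /andP[li lJ] E.
  by apply: inj => //; rewrite !ffunE (negPf ji) (negPf li).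
case/andP=> /forallP h /dinjectiveP inj.
have bi : b i == t0 by have := h i; rewrite !inE eqxx.
rewrite bi andbT; apply/andP; split.
  apply/forallP => j; have := h j; rewrite !inE ffunE.
  have [->|ji] /= := eqVneq j i; first by rewrite iJ.
  by case: ifP => // jJ /andP[].
have nx j : j \in J -> j != i -> b j != x.
  by move=> jJ ji; have := h j; rewrite !inE ji jJ => /andP[].
apply/dinjectiveP => j l jJ lJ; rewrite !ffunE.
have [->|ji] := eqVneq j i; have [->|li] := eqVneq l i => //.
- by move=> E; have := nx l lJ li; rewrite E eqxx.
- by move=> E; have := nx j jJ ji; rewrite E eqxx.
- by apply: inj; rewrite !inE ?ji ?li.
Qed.

(** Choose the value x at i first; the rest is an injection into what remains. *)
Lemma sum_pinj_pick (I T : finType) (t0 : T) (V : nmodType) (X : {set T}) (J : {set I})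
    (i : I) (Psi : {ffun I -> T} -> V) : i \in J ->
  \sum_(a | pinj t0 X J a) Psi a
  = \sum_(x in X) \sum_(b | pinj t0 (X :\ x) (J :\ i) b) Psi (upd b i x).
Proof.
move=> iJ; rewrite (partition_big (fun a : {ffun I -> T} => a i) (mem X)) /=; last first.
  by move=> a /andP[/forallP /(_ i)]; rewrite iJ.
apply: eq_bigr => x xX.
rewrite (reindex_onto (fun b => upd b i x) (fun a => upd a i t0)) /=; last first.
  move=> a /andP[_ /eqP ai]; apply/ffunP => j; rewrite !ffunE.
  by case: eqP => // ->.
apply: eq_bigl => b; rewrite -pinj_upd // -andbA; congr (_ && _).
rewrite !ffunE eqxx eqxx /=; apply/eqP/eqP => [<-|bi].
  by rewrite !ffunE eqxx.
by apply/ffunP => j; rewrite !ffunE; case: eqP => // ->.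
Qed.

Lemma pinj0 (I T : finType) (t0 : T) (X : {set T}) :
  pinj t0 X (set0 : {set I}) =1 pred1 [ffun=> t0].
Proof.
move=> a; apply/idP/eqP => [/andP[/forallP h _]|->].
  by apply/ffunP => i; have := h i; rewrite inE ffunE => /eqP.
apply/andP; split; first by apply/forallP => i; rewrite inE ffunE.
by apply/dinjectiveP => i j; rewrite inE.
Qed.

(** The coefficient of prod_(i in J) t_i in prod_(x in X) (1 + sum_i t_i f_i(x)),
    where the t_i have square zero. *)
Definition dsum (I T : finType) (t0 : T) (R : comNzRingType) (f : I -> T -> R)
    (X : {set T}) (J : {set I}) : R :=
  \sum_(a | pinj t0 X J a) \prod_(i in J) f i (a i).

Lemma dsum0 (I T : finType) (t0 : T) (R : comNzRingType) (f : I -> T -> R) X :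
  dsum t0 f X set0 = 1.
Proof. by rewrite /dsum (eq_bigl _ _ (pinj0 _ _)) big_pred1_eq big_set0. Qed.

Lemma prod_upd (I T : finType) (R : comNzRingType) (f : I -> T -> R)
    (J : {set I}) (b : {ffun I -> T}) i x :
  \prod_(j in J :\ i) f j (upd b i x j) = \prod_(j in J :\ i) f j (b j).
Proof.
by apply: eq_bigr => j; rewrite !inE ffunE => /andP[/negPf->].
Qed.

Lemma dsum_pick (I T : finType) (t0 : T) (R : comNzRingType) (f : I -> T -> R)
    (X : {set T}) (J : {set I}) i : i \in J ->
  dsum t0 f X J = \sum_(x in X) f i x * dsum t0 f (X :\ x) (J :\ i).
Proof.
move=> iJ; rewrite /dsum (sum_pinj_pick _ _ _ iJ); apply: eq_bigr => x xX.
rewrite mulr_sumr; apply: eq_bigr => b _.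
by rewrite (big_setD1 i) //= prod_upd ffunE eqxx.
Qed.

Lemma setD1C (T : finType) (A : {set T}) x y : A :\ x :\ y = A :\ y :\ x.
Proof. by rewrite !setDDl setUC. Qed.

(** The two terms correspond to the injections avoiding y and to those that take the
    value y, at a unique point i. *)
Lemma dsum_peel (I T : finType) (t0 : T) (R : comNzRingType) (f : I -> T -> R)
    (J : {set I}) (X : {set T}) y : y \in X ->
  dsum t0 f X J = dsum t0 f (X :\ y) J
    + \sum_(i in J) f i y * dsum t0 f (X :\ y) (J :\ i).
Proof.
have [m cardJ] := ubnP #|J|; elim: m => // m IH in J cardJ X *; move=> yX.
have [->|[i iJ]] := set_0Vmem J; first by rewrite !dsum0 big_set0 addr0.
have cJi : (#|J :\ i| < m)%N by rewrite (cardsD1 i) iJ in cardJ.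
rewrite !(dsum_pick _ _ _ iJ) (big_setD1 y) //= addrC.
rewrite [in RHS](big_setD1 i iJ) /= addrCA [RHS]addrC; congr (_ + _).
transitivity (\sum_(x in X :\ y) f i x * (dsum t0 f (X :\ y :\ x) (J :\ i)
    + \sum_(j in J :\ i) f j y * dsum t0 f (X :\ y :\ x) (J :\ i :\ j))).
  apply: eq_bigr => x; rewrite !inE => /andP[xy xX].
  by rewrite (IH _ cJi (X :\ x)) ?inE ?yX ?(eq_sym y) ?xy // setD1C.
under [LHS]eq_bigr do rewrite mulrDr.
rewrite big_split /= ; congr (_ + _).
under [LHS]eq_bigr do rewrite mulr_sumr.
rewrite exchange_big /=; apply: eq_bigr => j jJ.
have iJj : i \in J :\ j by move: jJ; rewrite !inE iJ eq_sym => /andP[->].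
rewrite (dsum_pick _ _ _ iJj) mulr_sumr; apply: eq_bigr => x _.
by rewrite mulrCA (setD1C J).
Qed.

Definition mprod (I T : finType) (R : comNzRingType) (f : I -> T -> R)
    (J : {set I}) (x : T) : R := \prod_(i in J) f i x.

Lemma mprodD1 (I T : finType) (R : comNzRingType) (f : I -> T -> R) (J : {set I}) i x :
  i \in J -> mprod f J x = f i x * mprod f (J :\ i) x.
Proof. by move=> iJ; rewrite /mprod (big_setD1 i). Qed.

(** The square-zero form of 1/(1 + F(y)): the peeling identity expresses the sum
    over X minus y through those for smaller J, all terms of which are equal. *)
Lemma dsum_minus1_card (I T : finType) (t0 : T) (R : comNzRingType) (f : I -> T -> R)
    (X : {set T}) (J : {set I}) y :
  (forall L : {set I}, L \subset J -> L != set0 -> dsum t0 f X L = 0) ->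
  y \in X ->
  dsum t0 f (X :\ y) J = (-1) ^+ #|J| * #|J|`!%:R * mprod f J y.
Proof.
have [m cardJ] := ubnP #|J|; elim: m => // m IH in J cardJ *; move=> X0 yX.
have [->|J0] := eqVneq J set0.
  by rewrite dsum0 cards0 expr0 fact0 /mprod big_set0 !mulr1.
have := dsum_peel t0 f J yX; rewrite X0 // => /esym/eqP.
rewrite addr_eq0 => /eqP ->.
transitivity (- \sum_(i in J) (-1) ^+ #|J|.-1 * #|J|.-1`!%:R * mprod f J y).
  congr (- _); apply: eq_bigr => i iJ.
  have ci : #|J :\ i| = #|J|.-1 by rewrite (cardsD1 i J) iJ.
  rewrite IH //.
  - by rewrite ci (mprodD1 _ _ iJ); ring.
  - by move: cardJ; rewrite ci; have := card_gt0 J; rewrite J0; lia.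
  - by move=> L LJ; apply: X0; apply: subset_trans LJ (subD1set _ _).
have cJ : (0 < #|J|)%N by rewrite card_gt0.
rewrite sumr_const -(prednK cJ) /= exprS factS natrM -mulr_natl.
by ring.
Qed.

(** By induction the sum over X minus x is a multiple of the product of the f_i(x),
    and so the sum over X is a multiple of a vanishing power sum. *)
Lemma dsum_eq0 (I T : finType) (t0 : T) (R : comNzRingType) (f : I -> T -> R)
    (X : {set T}) (J : {set I}) :
  (forall L : {set I}, L \subset J -> L != set0 -> \sum_(x in X) mprod f L x = 0) ->
  J != set0 -> dsum t0 f X J = 0.
Proof.
have [m cardJ] := ubnP #|J|; elim: m => // m IH in J cardJ *; move=> X0.
case/set0Pn=> i iJ; rewrite (dsum_pick _ _ _ iJ).
have cJi : (#|J :\ i| < m)%N by rewrite (cardsD1 i) iJ in cardJ.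
transitivity (\sum_(x in X) (-1) ^+ #|J :\ i| * #|J :\ i|`!%:R * mprod f J x).
  apply: eq_bigr => x xX; rewrite dsum_minus1_card //.
    by rewrite (mprodD1 _ _ iJ); ring.
  move=> L LJ; apply: IH; first exact: leq_ltn_trans (subset_leq_card LJ) cJi.
  move=> L' L'L; apply: X0; apply: subset_trans L'L _.
  exact: subset_trans LJ (subD1set _ _).
by rewrite -mulr_sumr X0 ?mulr0 //; apply/set0Pn; exists i.
Qed.

Lemma dsum_minus1 (I T : finType) (t0 : T) (R : comNzRingType) (f : I -> T -> R)
    (X : {set T}) (J : {set I}) y :
  (forall L : {set I}, L \subset J -> L != set0 -> \sum_(x in X) mprod f L x = 0) ->
  y \in X ->
  dsum t0 f (X :\ y) J = (-1) ^+ #|J| * #|J|`!%:R * mprod f J y.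
Proof.
move=> X0; apply: dsum_minus1_card => L LJ; apply: dsum_eq0 => L' L'L.
exact/X0/(subset_trans L'L).
Qed.

(** Both sides run over the pairs i in S; S is recorded on the left as i |: A. *)
Lemma sum_subsets_pick (I : finType) (V : nmodType) (J : {set I}) (G : I -> {set I} -> V) :
  \sum_(i in J) \sum_(A : {set I} | A \subset J :\ i) G i (i |: A)
  = \sum_(S : {set I} | (S \subset J) ) \sum_(i in S) G i S.
Proof.
rewrite (exchange_big_dep (mem J)) /=; last first.
  by move=> S i SJ iS; apply: (subsetP SJ).
apply: eq_bigr => i iJ.
rewrite [RHS](reindex_onto (fun A => i |: A) (fun S => S :\ i)) /=; last first.
  by move=> S /andP[_ iS]; rewrite setD1K.
apply: eq_bigl => A; rewrite subUset sub1set iJ setU11 andbT /=.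
rewrite subsetD1; congr (_ && _).
by apply/idP/eqP => [/setU1K //|<-]; rewrite setD11.
Qed.

(** The square-zero form of 1/((1 + F(x))(1 + F(y))), obtained by peeling x off
    [dsum_minus1]. *)
Lemma dsum_minus2 (I T : finType) (t0 : T) (R : comNzRingType) (f : I -> T -> R)
    (X : {set T}) (J : {set I}) x y :
  (forall L : {set I}, L \subset J -> L != set0 -> \sum_(x in X) mprod f L x = 0) ->
  y \in X -> x \in X -> x != y ->
  dsum t0 f (X :\ y :\ x) J = (-1) ^+ #|J| *
    \sum_(A : {set I} | A \subset J)
       (#|A|`! * #|J :\: A|`!)%:R * (mprod f A x * mprod f (J :\: A) y).
Proof.
have [m cardJ] := ubnP #|J|; elim: m => // m IH in J cardJ *; move=> X0 yX xX xy.
have xXy : x \in X :\ y by rewrite !inE xy.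
have := dsum_peel t0 f J xXy; rewrite dsum_minus1 // => /esym/eqP.
rewrite eq_sym -subr_eq => /eqP <-.
pose w (S : {set I}) : R := mprod f S x * mprod f (J :\: S) y.
transitivity ((-1) ^+ #|J| * #|J|`!%:R * mprod f J y + (-1) ^+ #|J| *
  \sum_(i in J) \sum_(A : {set I} | A \subset J :\ i)
      (#|i |: A|.-1`! * #|J :\: (i |: A)|`!)%:R * w (i |: A)).
  congr (_ + _).
  rewrite [RHS]mulr_sumr -sumrN; apply: eq_bigr => i iJ.
  have ci : #|J| = #|J :\ i|.+1 by rewrite (cardsD1 i J) iJ.
  rewrite IH //; first last.
  - by move=> L LJ; apply: X0; apply: subset_trans LJ (subD1set _ _).
  - by rewrite ci in cardJ.
  rewrite mulrCA -mulNr ci exprS mulN1r; congr (_ * _).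
  rewrite mulr_sumr; apply: eq_bigr => A; rewrite subsetD1 => /andP[AJ iA].
  rewrite /w cardsU1 iA add1n /= (mprodD1 _ _ (setU11 i A)) setU1K // setDDl.
  by ring.
rewrite (sum_subsets_pick _ (fun=> fun S => (#|S|.-1`! * #|J :\: S|`!)%:R * w S)).
rewrite -mulrA -mulrDr; congr (_ * _).
rewrite [X in _ + X = _](bigD1 set0) ?sub0set //= [RHS](bigD1 set0) ?sub0set //=.
rewrite addrA; congr (_ + _).
  rewrite big_set0 addr0 cards0 setD0 mul1n.
  by rewrite [in RHS]/mprod big_set0 mul1r.
apply: eq_bigr => S /andP[SJ S0]; rewrite sumr_const -[_ *+ #|S|]mulr_natl mulrA -natrM.
have cS : (0 < #|S|)%N by rewrite card_gt0.
by rewrite mulnA -[in X in (X * _)%N](prednK cS) -factS prednK.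
Qed.

(** Fix the values y at i0 and x at i, and apply [dsum_minus2] to the remaining
    points.  The set S collects i and the points merged with it; its |S| possible
    choices of i turn (|S| - 1)! into |S|!. *)
Lemma sum_pinj_pairs (I T : finType) (t0 : T) (R : comNzRingType) (f : I -> T -> R)
    (g : T -> T -> R) (i0 : I) (X : {set T}) :
  (forall L : {set I}, L \subset [set~ i0] -> L != set0 ->
     \sum_(x in X) mprod f L x = 0) ->
  (forall x, g x x = 0) ->
  \sum_(a | pinj t0 X [set: I] a)
     (\prod_i f i (a i)) * \sum_(i in [set~ i0]) g (a i) (a i0)
  = (-1) ^+ #|[set~ i0]|.-1 *
    \sum_(S : {set I} | (S \subset [set~ i0]) && (S != set0))
      (#|S|`! * #|[set~ i0] :\: S|`!)%:R *
      \sum_(y in X) \sum_(x in X)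
        g x y * mprod f S x * mprod f (~: S) y.
Proof.
move=> X0 gxx; set J := [set~ i0].
pose w (S : {set I}) : R :=
  \sum_(y in X) \sum_(x in X) g x y * mprod f S x * mprod f (~: S) y.
have J_T : [set: I] :\ i0 = J by apply/setP => i; rewrite !inE andbT.
under eq_bigr do rewrite mulr_sumr.
rewrite exchange_big /=.
transitivity ((-1) ^+ #|J|.-1 * \sum_(i in J) \sum_(A : {set I} | A \subset J :\ i)
   (#|i |: A|.-1`! * #|J :\: (i |: A)|`!)%:R * w (i |: A)).
  rewrite mulr_sumr; apply: eq_bigr => i iJ.
  have ii0 : i != i0 by move: iJ; rewrite !inE.
  rewrite (sum_pinj_pick _ _ _ (in_setT i0)) J_T.
  transitivity (\sum_(y in X) \sum_(x in X :\ y)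
     g x y * (f i x * f i0 y) * dsum t0 f (X :\ y :\ x) (J :\ i)).
    apply: eq_bigr => y yX; rewrite (sum_pinj_pick _ _ _ iJ).
    apply: eq_bigr => x _; rewrite /dsum mulr_sumr; apply: eq_bigr => b _.
    rewrite !ffunE (negPf ii0) !eqxx.
    rewrite (bigD1 i0) //= (bigD1 i) //= !ffunE (negPf ii0) !eqxx.
    rewrite (eq_big (mem (J :\ i)) (fun j => f j (b j))).
    - by ring.
    - by move=> j; rewrite !inE andbC.
    - by move=> j /andP[ji0 ji]; rewrite !ffunE (negPf ji0) (negPf ji).
  have cJi : #|J :\ i| = #|J|.-1 by rewrite (cardsD1 i J) iJ.
  transitivity (\sum_(y in X) \sum_(x in X) \sum_(A : {set I} | A \subset J :\ i)
    (-1) ^+ #|J|.-1 * ((#|i |: A|.-1`! * #|J :\: (i |: A)|`!)%:R *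
       (g x y * mprod f (i |: A) x * mprod f (~: (i |: A)) y))).
    apply: eq_bigr => y yX; rewrite [RHS](big_setD1 y) //=.
    rewrite [X in _ = X + _]big1 ?add0r; last first.
      by move=> A _; rewrite gxx !(mul0r, mulr0).
    apply: eq_bigr => x; rewrite !inE => /andP[xy xX].
    rewrite dsum_minus2 //; last first.
      by move=> L LJ; apply: X0; apply: subset_trans LJ (subD1set _ _).
    rewrite cJi mulrCA mulr_sumr mulr_sumr; apply: eq_bigr => A.
    rewrite subsetD1 => /andP[AJ iA].
    rewrite cardsU1 iA add1n /= (mprodD1 _ _ (setU11 i A)) setU1K // setDDl.
    have i0S : i0 \in ~: (i |: A).
      rewrite !inE negb_or eq_sym ii0 /=; apply/negP => i0A.
      by have := subsetP AJ _ i0A; rewrite !inE eqxx.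
    have -> : J :\: (i |: A) = (~: (i |: A)) :\ i0.
      by apply/setP => j; rewrite !inE andbC.
    rewrite [mprod f (~: _) y](mprodD1 _ _ i0S).
    by ring.
  rewrite mulr_sumr; under eq_bigr do rewrite exchange_big /=.
  rewrite exchange_big /=; apply: eq_bigr => A _.
  rewrite /w 2!mulr_sumr; apply: eq_bigr => y _.
  by rewrite 2!mulr_sumr.
rewrite (sum_subsets_pick _ (fun=> fun S => (#|S|.-1`! * #|J :\: S|`!)%:R * w S)).
congr (_ * _).
rewrite (bigD1 set0) ?sub0set //= big_set0 add0r.
apply: eq_bigr => S /andP[SJ S0]; rewrite sumr_const -[_ *+ #|S|]mulr_natl mulrA -natrM.
have cS : (0 < #|S|)%N by rewrite card_gt0.
by rewrite mulnA -[in X in (X * _)%N](prednK cS) -factS prednK.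
Qed.

(** * Sorting tuples of distinct elements *)

Definition rank (r q : nat) (a : 'I_r -> 'I_q) (i : 'I_r) : nat :=
  #|[set j | (a j < a i)%N]|.

Definition increasing (r q : nat) (a : 'I_r -> 'I_q) : bool :=
  [forall i : 'I_r, forall j : 'I_r, (i < j)%N ==> (a i < a j)%N].

Lemma increasingP (r q : nat) (a : 'I_r -> 'I_q) :
  reflect {homo a : i j / (i < j)%N} (increasing a).
Proof.
apply: (iffP forallP) => [h i j ij|h i].
  by have /forallP /(_ j) /implyP := h i; apply.
by apply/forallP => j; apply/implyP; apply: h.
Qed.

Lemma increasing_mono (r q : nat) (a : 'I_r -> 'I_q) : increasing a ->
  {mono a : i j / (i < j)%N}.
Proof.
move/increasingP=> h i j; apply/idP/idP; last exact: h.
rewrite !ltnNge; apply: contra; rewrite leq_eqVlt => /orP[/eqP/val_inj->//|/h].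
exact: ltnW.
Qed.

Lemma rank_lt (r q : nat) (a : 'I_r -> 'I_q) i : (rank a i < r)%N.
Proof.
rewrite -[X in (_ < X)%N](card_ord r) -cardsT; apply: proper_card.
by apply/properP; split; [exact: subsetT | exists i; rewrite !inE ?ltnn].
Qed.

Lemma rank_ltE (r q : nat) (a : 'I_r -> 'I_q) i j :
  (rank a i < rank a j)%N = (a i < a j)%N.
Proof.
have le_rank k l : (a k <= a l)%N -> (rank a k <= rank a l)%N.
  move=> kl; apply/subset_leq_card/subsetP => x; rewrite !inE => xk.
  exact: leq_trans xk kl.
apply/idP/idP => [|ij]; first by apply: contraTT; rewrite -!leqNgt; exact: le_rank.
apply: proper_card; apply/properP; split.
  by apply/subsetP => x; rewrite !inE => /ltn_trans; apply.
by exists i; rewrite !inE ?ltnn.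
Qed.

Lemma card_ord_lt (r k : nat) : (k <= r)%N -> #|[set l : 'I_r | (l < k)%N]| = k.
Proof.
move=> kr; rewrite -sum1dep_card -(big_ord_widen_cond r xpredT (fun=> 1%N)) //.
by rewrite sum1_card card_ord.
Qed.

(** Through s^-1, the j with a_j < a_i are the indices below s^-1(i). *)
Lemma increasing_perm_rank (r q : nat) (a : 'I_r -> 'I_q) (s : 'S_r) i :
  increasing (a \o s) -> (s^-1)%g i = rank a i :> nat.
Proof.
move=> inc; rewrite /rank -(card_imset _ (@perm_inj _ s^-1%g)).
rewrite (_ : _ @: _ = [set l : 'I_r | (l < (s^-1)%g i)%N]).
  by rewrite card_ord_lt // ltnW.
apply/setP => l; rewrite -{1}(permK s l) mem_imset; last exact: perm_inj.
by rewrite !inE -(increasing_mono inc) /= permKV.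
Qed.

(** An injective tuple a is sorted by exactly one permutation, the inverse of its rank
    function. *)
Lemma sum_sorted (V : nmodType) (r q : nat) (i0 : 'I_r)
    (Phi : nat -> {ffun 'I_r -> 'I_q} -> V) :
  \sum_(s : 'S_r) \sum_(m : {ffun 'I_r -> 'I_q} | increasing m)
     Phi ((s^-1)%g i0) [ffun i => m ((s^-1)%g i)]
  = \sum_(a : {ffun 'I_r -> 'I_q} | injectiveb a) Phi (rank a i0) a.
Proof.
transitivity (\sum_(s : 'S_r) \sum_(a : {ffun 'I_r -> 'I_q} | increasing (a \o s))
     Phi ((s^-1)%g i0) a).
  apply: eq_bigr => s _.
  rewrite (reindex (fun a : {ffun 'I_r -> 'I_q} => [ffun i => a (s i)])) /=.
    apply: eq_big => [a|a _]; last first.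
      by congr Phi; apply/ffunP => i; rewrite !ffunE permKV.
    by apply/increasingP/increasingP => h i j /h; rewrite /= !ffunE.
  exists (fun a => [ffun i => a ((s^-1)%g i)]) => a _; apply/ffunP => i;
    by rewrite !ffunE ?permK ?permKV.
rewrite (exchange_big_dep (fun a : {ffun 'I_r -> 'I_q} => injectiveb a)) /=; last first.
  move=> s a _ /increasing_mono h; apply/injectiveP => i j aij.
  apply: (@perm_inj _ s^-1%g); apply/val_inj/eqP.
  have hh k l := h ((s^-1)%g k) ((s^-1)%g l); rewrite /= in hh.
  have := hh i j; have := hh j i; rewrite !permKV aij ltnn.
  by move=> h1 h2; rewrite eqn_leq leqNgt [X in _ && X]leqNgt -h1 -h2.
apply: eq_bigr => a /injectiveP inja.
pose rk i := Ordinal (rank_lt a i).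
have rk_inj : injective rk.
  move=> i j /(congr1 val) /= E; apply: inja; apply/val_inj/eqP.
  by rewrite eqn_leq leqNgt [X in _ && X]leqNgt -!rank_ltE E ltnn.
rewrite (big_pred1 (perm rk_inj)^-1%g) /=.
  by rewrite invgK permE.
move=> s; apply/idP/eqP => [inc|->].
  apply: invg_inj; rewrite invgK; apply/permP => i; apply/val_inj.
  by rewrite permE /= (increasing_perm_rank _ inc).
apply/increasingP => i j ij /=; rewrite -rank_ltE.
have E k : rank a ((perm rk_inj)^-1%g k) = k.
  by rewrite -[in RHS](permKV (perm rk_inj) k) [in RHS]permE.
by rewrite !E.
Qed.

(** * Permutations with a prescribed image *)

(** Assign first the values on J0, which exhaust X0, then those on the rest of J. *)
Lemma card_pinj_onto (I T : finType) (t0 : T) (J0 J : {set I}) (X0 X : {set T}) :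
  J0 \subset J -> X0 \subset X -> #|J0| = #|X0| -> #|J| = #|X| ->
  (\sum_(a | pinj t0 X J a) [forall i in J0, a i \in X0] = #|J0|`! * #|J :\: J0|`!)%N.
Proof.
have [m cardJ] := ubnP #|J|; elim: m => // m IH in J cardJ J0 X0 X *.
move=> J0J X0X c0 c.
have [J00|[i iJ0]] := set_0Vmem J0.
  have X00 : X0 = set0 by apply: cards0_eq; rewrite -c0 J00 cards0.
  subst J0 X0.
  have [J_0|[i iJ]] := set_0Vmem J.
    rewrite J_0 (eq_bigl _ _ (pinj0 _ _)) big_pred1_eq setD0 cards0 muln1.
    by case: forallP => //; case=> i; rewrite inE.
  rewrite (sum_pinj_pick _ _ _ iJ) (eq_bigr (fun=> (#|J|.-1)`!)).
    rewrite sum_nat_const -c cards0 setD0 mul1n.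
    have cJ : (0 < #|J|)%N by apply/card_gt0P; exists i.
    by rewrite -{1 3}(prednK cJ) factS.
  move=> x xX.
  have cJi : #|J :\ i| = #|J|.-1 by rewrite (cardsD1 i J) iJ.
  transitivity (\sum_(a | pinj t0 (X :\ x) (J :\ i) a)
     [forall i in (set0 : {set I}), a i \in (set0 : {set T})])%N.
    by apply: eq_bigr => b _; congr nat_of_bool; apply: eq_forallb => j; rewrite !inE.
  rewrite IH ?sub0set ?cards0 ?setD0 ?mul1n ?cJi //.
    by move: cardJ; rewrite (cardsD1 i J) iJ; lia.
  by rewrite c (cardsD1 x X) xX.
have iJ := subsetP J0J _ iJ0.
have cJi : #|J :\ i| = #|J|.-1 by rewrite (cardsD1 i J) iJ.
rewrite (sum_pinj_pick _ _ _ iJ).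
have inner x : x \in X -> (\sum_(b | pinj t0 (X :\ x) (J :\ i) b)
    [forall i1 in J0, upd b i x i1 \in X0]
    = (x \in X0) * (#|J0|.-1`! * #|J :\: J0|`!))%N.
  move=> xX; case xX0 : (x \in X0); last first.
    rewrite mul0n big1 // => b _; apply/eqP; rewrite eqb0; apply/negP => /forallP /(_ i).
    by rewrite iJ0 ffunE eqxx xX0.
  rewrite mul1n.
  transitivity (\sum_(a | pinj t0 (X :\ x) (J :\ i) a)
     [forall j in J0 :\ i, a j \in X0 :\ x])%N.
    apply: eq_bigr => b /andP[/forallP hb _]; congr nat_of_bool.
    apply/forall_inP/forall_inP => h j.
      rewrite in_setD1 => /andP[ji jJ0].
      have := h j jJ0; rewrite ffunE (negPf ji) => bX0.
      by have := hb j; rewrite !inE ji (subsetP J0J _ jJ0) bX0 => /andP[->].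
    move=> jJ0; rewrite ffunE; case: (eqVneq j i) => // ji.
    by have := h j; rewrite !inE ji jJ0 => /(_ isT) /andP[].
  rewrite IH.
  - have -> : (J :\ i) :\: (J0 :\ i) = J :\: J0.
      by apply/setP => j; rewrite !inE; case: eqVneq => // ->; rewrite iJ0.
    by rewrite (cardsD1 i J0) iJ0.
  - by move: cardJ; rewrite (cardsD1 i J) iJ; lia.
  - exact: setSD.
  - exact: setSD.
  - by have := cardsD1 i J0; have := cardsD1 x X0; rewrite iJ0 xX0; lia.
  - by have := cardsD1 i J; have := cardsD1 x X; rewrite iJ xX; lia.
rewrite (eq_bigr _ inner) -big_distrl /=.
have -> : (\sum_(x in X) (x \in X0) = #|X0|)%N.
  rewrite -big_mkcondr -sum1_card; apply: eq_bigl => x.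
  by rewrite andb_idl //; exact: (subsetP X0X).
have c0_gt0 : (0 < #|J0|)%N by apply/card_gt0P; exists i.
transitivity (#|X0| * (#|J0|.-1`! * #|J :\: J0|`!))%N => //.
by rewrite -c0 mulnA -{1}(prednK c0_gt0) -factS prednK.
Qed.

Lemma card_perm_onto (I : finType) (i0 : I) (A S : {set I}) : #|A| = #|S| ->
  #|[set t : {perm I} | t @: A == S]| = (#|A|`! * #|~: A|`!)%N.
Proof.
move=> c; rewrite -setTD -(card_pinj_onto i0 (subsetT A) (subsetT S)) //.
rewrite -big_mkcondr sum1_card -(card_imset _ val_inj).
apply: eq_card => a; apply/imsetP/andP => [[t]|[/andP[_ /dinjectiveP inj] aAS]].
  rewrite inE => /eqP tAS ->; split.
    apply/andP; split; first by apply/forallP => i; rewrite !inE.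
    by apply/dinjectiveP => i j _ _; rewrite /= !pvalE; apply: perm_inj.
  by apply/forall_inP => i iA; rewrite /= pvalE -tAS imset_f.
have inja : injective a by move=> i j; apply: inj; rewrite inE.
exists (perm inja); last by apply/ffunP => i; rewrite /= pvalE permE.
rewrite inE eqEcard card_imset ?c ?leqnn ?andbT; last exact: perm_inj.
by apply/subsetP => _ /imsetP[i iA ->]; rewrite permE; apply: (forall_inP aAS).
Qed.

Lemma sum_perm_imset (I : finType) (i0 : I) (V : nmodType) (A : {set I})
    (Phi : {set I} -> V) :
  \sum_(t : {perm I}) Phi (t @: A)
  = \sum_(S : {set I} | #|S| == #|A|) Phi S *+ (#|S|`! * #|~: S|`!).
Proof.
rewrite (partition_big (fun t : {perm I} => t @: A) (fun S => #|S| == #|A|)) /=; last first.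
  by move=> t _; rewrite card_imset //; exact: perm_inj.
apply: eq_bigr => S /eqP cS.
have -> : (#|S|`! * #|~: S|`! = #|A|`! * #|~: A|`!)%N.
  by rewrite [#|~: S|]cardsCs [#|~: A|]cardsCs !setCK cS.
rewrite -(card_perm_onto i0 (esym cS)) -sumr_const.
by apply: eq_big => [t|t /eqP ->]; rewrite ?inE.
Qed.

(** A nonempty S is the image of an initial segment only for j = |S|. *)
Lemma sum_perm_prefix (V : nmodType) (n : nat) (Phi : {set 'I_n.+1} -> V) :
  \sum_(t : 'S_n.+1) \sum_(1 <= j < n.+2) Phi (t @: [set i : 'I_n.+1 | (i < j)%N])
  = \sum_(S : {set 'I_n.+1} | S != set0) Phi S *+ (#|S|`! * #|~: S|`!).
Proof.
rewrite exchange_big /=.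
transitivity (\sum_(1 <= j < n.+2) \sum_(S : {set 'I_n.+1} | #|S| == j)
    Phi S *+ (#|S|`! * #|~: S|`!)).
  apply: eq_big_nat => j jn; rewrite (sum_perm_imset ord0) card_ord_lt //; lia.
rewrite (exchange_big_dep xpredT) //= [RHS]big_mkcond /=; apply: eq_bigr => S _.
have [->|S0] := eqVneq S set0.
  by rewrite big_nat_cond big_pred0 // => j; rewrite cards0; case: j => [|j]; rewrite ?andbF.
under eq_bigl do rewrite eq_sym.
have cS : (#|S| < n.+2)%N by rewrite ltnS -[X in (_ <= X)%N](card_ord n.+1) max_card.
by rewrite big_nat1_eq cS card_gt0 S0.
Qed.

(** * The binomial side *)

(** The partial sums of C only involve even exponents, so all its signs are +1. *)
Lemma Ccoef_lift_perm (n : nat) (k : 'I_n.+1 -> nat) (t : 'S_n) :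
  (forall i : 'I_n.+1, (i < n)%N -> ~~ odd (k i)) ->
  Ccoef (fun i => k (lift_perm ord_max ord_max t i))
  = \sum_(1 <= j < n.+1) ('C(\sum_i k i,
       \sum_(i in t @: [set i : 'I_n | (i < j)%N]) k (lift ord_max i)))%N%:Z.
Proof.
move=> k_even; rewrite /Ccoef; apply: eq_big_nat => j jn.
have -> : (\sum_i k (lift_perm ord_max ord_max t i) = \sum_i k i)%N.
  by rewrite [RHS](reindex_inj (@perm_inj _ (lift_perm ord_max ord_max t))).
have -> : (\sum_(i < n.+1 | (i < j)%N) k (lift_perm ord_max ord_max t i)
    = \sum_(i in t @: [set i : 'I_n | (i < j)%N]) k (lift ord_max i))%N.
  rewrite big_imset /=; last by move=> ? ? _ _; apply: perm_inj.
  rewrite big_mkcond big_ord_recr /= ltnNge (_ : (j <= n)%N) ?addn0 //=; last by lia.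
  rewrite [RHS](eq_bigl (fun i : 'I_n => (i < j)%N)); last by move=> i; rewrite inE.
  rewrite [RHS]big_mkcond /=; apply: eq_bigr => i _.
  have -> : widen_ord (leqnSn n) i = lift ord_max i.
    by apply/val_inj; rewrite /= /bump leqNgt ltn_ord.
  by rewrite lift_perm_lift.
set e := (\sum_(i in _) _)%N.
have e_even : ~~ odd e.
  rewrite /e; elim/big_ind: _ => // [a b|i _]; first by rewrite oddD => /negPf-> /negPf->.
  by apply: k_even; rewrite lift_max.
by rewrite -signr_odd (negPf e_even) mul1r.
Qed.

Lemma sum_subsets_lift_max (V : nmodType) (n : nat) (G : {set 'I_n.+1} -> V) :
  \sum_(S : {set 'I_n} | S != set0) G (lift ord_max @: S)
  = \sum_(S : {set 'I_n.+1} | (S \subset [set~ ord_max]) && (S != set0)) G S.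
Proof.
have injl : injective (lift (@ord_max n)) by exact: lift_inj.
rewrite [RHS](reindex_onto (fun S : {set 'I_n} => lift ord_max @: S)
   (fun S => lift ord_max @^-1: S)) /=; last first.
  move=> S /andP[/subsetP SJ _]; apply/setP => i; apply/imsetP/idP => [[j]|iS].
    by rewrite inE => jS ->.
  have := SJ i iS; rewrite !inE eq_sym => /unlift_some[j ij _].
  by exists j; rewrite // inE -ij.
apply: eq_bigl => S.
have -> : lift ord_max @: S \subset [set~ ord_max].
  by apply/subsetP => _ /imsetP[j _ ->]; rewrite !inE eq_sym neq_lift.
have -> : lift ord_max @^-1: (lift ord_max @: S) == S.
  by apply/eqP/setP => i; rewrite inE mem_imset.
by rewrite andbT imset_eq0.
Qed.

Lemma sum_Ccoef (n : nat) (k : 'I_n.+2 -> nat) :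
  (forall i : 'I_n.+2, (i < n.+1)%N -> ~~ odd (k i)) ->
  \sum_(t : 'S_n.+1) Ccoef (fun i => k (lift_perm ord_max ord_max t i))
  = \sum_(S : {set 'I_n.+2} | (S \subset [set~ ord_max]) && (S != set0))
     ((#|S|`! * #|[set~ ord_max] :\: S|`!) * 'C(\sum_i k i, \sum_(i in S) k i))%N%:Z.
Proof.
move=> k_even; rewrite (eq_bigr _ (fun t _ => Ccoef_lift_perm t k_even)).
rewrite (sum_perm_prefix (fun S => ('C(\sum_i k i, \sum_(i in S) k (lift ord_max i)))%N%:Z)).
rewrite -sum_subsets_lift_max; apply: eq_bigr => S _.
have injl : injective (lift (@ord_max n.+1)) by exact: lift_inj.
have -> : #|[set~ ord_max] :\: lift ord_max @: S| = #|~: S|.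
  have -> : [set~ ord_max] :\: lift ord_max @: S = lift ord_max @: ~: S.
    apply/setP => i; rewrite !inE; apply/andP/imsetP => [[iS]|[j]].
      rewrite eq_sym => /unlift_some[j ij _]; exists j => //.
      by rewrite inE; apply: contra iS => jS; rewrite ij imset_f.
    by rewrite inE => jS ->; rewrite mem_imset // jS eq_sym neq_lift.
  by rewrite card_imset.
rewrite card_imset // big_imset /=; last by move=> ? ? _ _; apply: injl.
by rewrite -mulr_natl -natz -natrM natz.
Qed.

(** * The identity at one prime *)

(** Off i0, the sign of a_i - a_i0 is 1 - 2 [a_i < a_i0]. *)
Lemma sum_sgn_rank (R : pzRingType) (r q : nat) (a : 'I_r.+1 -> 'I_q) (i0 : 'I_r.+1) :
  injective a ->
  \sum_(i in [set~ i0]) ((a i0 < a i)%N%:R - (a i < a i0)%N%:R)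
  = (r%:Z - 2 * (rank a i0)%:Z)%:~R :> R.
Proof.
move=> inja.
have rankE : rank a i0 = (\sum_(i in [set~ i0]) (a i < a i0))%N.
  rewrite /rank -sum1dep_card big_mkcond [RHS]big_mkcond /=; apply: eq_bigr => i _.
  by rewrite !inE; case: (eqVneq i i0) => [->|_]; rewrite ?ltnn //; case: ifP.
transitivity (\sum_(i in [set~ i0]) (1 - 2%:R * (a i < a i0)%N%:R : R)).
  apply: eq_bigr => i; rewrite !inE => ii0.
  have : (a i != a i0 :> nat) by apply: contra ii0 => /eqP/val_inj/inja ->.
  rewrite neq_ltn; case: ltngtP => //= _ _; rewrite ?mulr0 ?mulr1 ?sub0r ?subr0 //.
  by rewrite -[2%:R]/(1 + 1) opprD addrA subrr sub0r.
rewrite sumrB sumr_const cardsC1 card_ord -mulr_sumr -natr_sum -rankE.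
by rewrite intrB intrM.
Qed.

Lemma sum_half_ord (V : nmodType) (p : nat) (G : nat -> V) : odd p ->
  \sum_(x in [set x : 'I_p | (0 < x)%N && (2 * x < p)%N]) G x
  = \sum_(1 <= x < p./2.+1) G x.
Proof.
move=> op; rewrite (eq_bigl (fun x : 'I_p => (0 < x)%N && (2 * x < p)%N)); last first.
  by move=> x; rewrite inE.
rewrite -(big_mkord (fun x => (0 < x)%N && (2 * x < p)%N) G).
rewrite (big_cat_nat (n := p./2.+1)) //=; last by lia.
rewrite [X in _ + X]big_nat_cond [X in _ + X]big_pred0 ?addr0; last by move=> x; lia.
rewrite big_ltn_cond // ltnn /= big_nat_cond [RHS]big_nat_cond.
by apply: eq_bigl => x; lia.
Qed.

Lemma mprod_exprV (I T : finType) (F : fieldType) (k : I -> nat) (u : T -> F)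
    (S : {set I}) (x : T) :
  mprod (fun i x => u x ^- k i) S x = u x ^- (\sum_(i in S) k i).
Proof. by rewrite /mprod prodfV prodrXr. Qed.

(** The component of [zetaA2] at p.  Here p is a plain number, so that elements of
    ['I_p] and ['F_p] can be handled without the projection from [primeN]. *)
Definition zeta_half (p r : nat) (k : 'I_r -> nat) : 'F_p :=
  \sum_(m : {ffun 'I_r -> 'I_p} |
          [&& [forall i : 'I_r, 0 < m i]%N, increasing m
            & [forall i : 'I_r, 2 * m i < p]%N])
      \prod_(i < r) (m i)%:R ^- k i.

Lemma pinjT (I T : finType) (t0 : T) (X : {set T}) (a : {ffun I -> T}) :
  pinj t0 X [set: I] a = [forall i, a i \in X] && injectiveb a.
Proof.
congr (_ && _); first by apply: eq_forallb => i; rewrite in_setT.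
apply/dinjectiveP/injectiveP => inj i j; last by move=> _ _; apply: inj.
by apply: inj; rewrite in_setT.
Qed.

Lemma sum_perm_zeta_half (p n : nat) (k : 'I_n.+1 -> nat) (t0 : 'I_p) :
  let X := [set x : 'I_p | (0 < x)%N && (2 * x < p)%N] in
  \sum_(s : 'S_n.+1) zeta_half p (fun i => k (s i))
     *~ ((n.+1)%:Z + 1 - 2 * (((s^-1)%g ord_max).+1)%:Z)
  = \sum_(a : {ffun 'I_n.+1 -> 'I_p} | pinj t0 X [set: 'I_n.+1] a)
     (\prod_i (a i)%:R ^- k i) * \sum_(i in [set~ ord_max])
        ((a ord_max < a i)%N%:R - (a i < a ord_max)%N%:R).
Proof.
move=> X.
pose w (c : nat) : int := n%:Z - 2 * c%:Z.
pose Phi (c : nat) (a : {ffun 'I_n.+1 -> 'I_p}) : 'F_p :=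
  if [forall i, a i \in X] then (\prod_i (a i)%:R ^- k i) *~ w c else 0.
transitivity (\sum_(s : 'S_n.+1) \sum_(m : {ffun 'I_n.+1 -> 'I_p} | increasing m)
     Phi ((s^-1)%g ord_max) [ffun i => m ((s^-1)%g i)]).
  apply: eq_bigr => s _; rewrite /zeta_half mulrz_suml big_mkcond [RHS]big_mkcond /=.
  have -> : (n.+1)%:Z + 1 - 2 * (((s^-1)%g ord_max).+1)%:Z = w ((s^-1)%g ord_max).
    by rewrite /w; lia.
  apply: eq_bigr => m _; rewrite /Phi andbCA.
  case: (increasing m) => //=.
  have -> : [forall i, [ffun i => m ((s^-1)%g i)] i \in X]
      = [forall i : 'I_n.+1, (0 < m i)%N] && [forall i : 'I_n.+1, (2 * m i < p)%N].
    apply/forallP/andP => [h|[/forallP h1 /forallP h2] i].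
      by split; apply/forallP => i; have := h (s i); rewrite ffunE permK inE => /andP[].
    by rewrite ffunE inE h1 h2.
  case: ifP => [_|//]; apply: (congr1 (fun u => u *~ w ((s^-1)%g ord_max))).
  rewrite [RHS](reindex_inj (@perm_inj _ s)) /=.
  by apply: eq_bigr => i _; rewrite ffunE permK.
rewrite sum_sorted big_mkcond [RHS]big_mkcond /=; apply: eq_bigr => a _.
rewrite pinjT andbC; case: injectiveP => //= inja.
rewrite /Phi; case: ifP => // _.
by rewrite (sum_sgn_rank _ _ inja) -/(w _) mulrzr.
Qed.

Lemma theorem_Fp (n p : nat) (k : 'I_n.+2 -> nat) :
    (forall i, (0 < k i)%N) ->
    (forall i : 'I_n.+2, (i < n.+1)%N -> ~~ odd (k i)) ->
    odd (k ord_max) -> prime p -> (\sum_i k i < p.-1)%N ->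
  \sum_(s : 'S_n.+2) zeta_half p (fun i => k (s i))
     *~ ((n.+2)%:Z + 1 - 2 * (((s^-1)%g ord_max).+1)%:Z)
  = (-1) ^+ n.+2 *
    (ratr (bernoulli (p - \sum_i k i) / (\sum_i k i)%:R)
       *~ \sum_(t : 'S_n.+1) Ccoef (fun i => k (lift_perm ord_max ord_max t i))).
Proof.
move=> k_gt0 k_even k_odd pr; set K := (\sum_i k i)%N => Kp.
have K_gt1 : (1 < K)%N.
  rewrite /K big_ord_recl (bigD1 ord_max) //=.
  by have := k_gt0 ord0; have := k_gt0 (lift ord0 ord_max); lia.
have op : odd p by case: (even_prime pr) => // p2; lia.
set X := [set x : 'I_p | (0 < x)%N && (2 * x < p)%N].
pose f (i : 'I_n.+2) (x : 'I_p) : 'F_p := x%:R ^- k i.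
pose J := [set~ (ord_max : 'I_n.+2)].
have fE (S : {set 'I_n.+2}) x : mprod f S x = x%:R ^- (\sum_(i in S) k i).
  exact: (mprod_exprV k (fun x : 'I_p => x%:R)).
have even_S (S : {set 'I_n.+2}) : S \subset J -> ~~ odd (\sum_(i in S) k i).
  move=> SJ; elim/big_ind: _ => // [a b|i iS].
    by rewrite oddD => /negPf-> /negPf->.
  apply: k_even; have := subsetP SJ _ iS; rewrite !inE -val_eqE /=.
  by have := ltn_ord i; lia.
have S_gt0 (S : {set 'I_n.+2}) : S != set0 -> (0 < \sum_(i in S) k i)%N.
  by case/set0Pn => i iS; rewrite (bigD1 i) //= addn_gt0 k_gt0.
have K_split (S : {set 'I_n.+2}) : K = (\sum_(i in S) k i + \sum_(i in ~: S) k i)%N.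
  rewrite /K (bigID (mem S)) /=; congr (_ + _)%N.
  by apply: eq_bigl => i; rewrite inE.
rewrite (sum_perm_zeta_half _ (Ordinal (prime_gt0 pr))) -/X -/J.
rewrite (@sum_pinj_pairs _ _ _ _ f (fun x y : 'I_p => (y < x)%N%:R - (x < y)%N%:R)); last first.
- by move=> x; rewrite ltnn subrr.
- move=> L LJ L0; under eq_bigr do rewrite fE.
  rewrite (sum_half_ord (fun x => x%:R ^- _)) // sum_half_even ?even_S //.
  by rewrite S_gt0 // ; have := K_split L; lia.
rewrite -/J sum_Ccoef // -/J -/K.
have -> : #|J|.-1 = n by rewrite cardsC1 card_ord.
rewrite exprS exprS !mulN1r opprK; congr (_ * _).
rewrite mulrz_sumr; apply: eq_bigr => S /andP[SJ S0].
set e := (\sum_(i in S) k i)%N; pose o := (\sum_(i in ~: S) k i)%N.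
have Keo : K = (e + o)%N := K_split S.
have e0 : (0 < e)%N := S_gt0 S S0.
have ee : ~~ odd e := even_S S SJ.
have oo : odd o.
  have max_S : ord_max \in ~: S.
    by rewrite inE; apply/negP => /(subsetP SJ); rewrite !inE eqxx.
  rewrite /o (big_setD1 ord_max) //= oddD k_odd /= even_S //.
  by apply/subsetP => i; rewrite !inE => /andP[].
transitivity ((#|S|`! * #|J :\: S|`!)%:R *
    ('C(e + o, e)%:R * (ratr (bernoulli (p - (e + o))) / (e + o)%:R)) : 'F_p).
  congr (_ * _); rewrite -(sum_sgn_half pr op ee oo e0) -?Keo //.
  rewrite -(sum_half_ord (fun y => \sum_(1 <= x < p./2.+1) _ )) //.
  apply: eq_bigr => y _.
  rewrite -(sum_half_ord (fun x => _ * x%:R ^- e * y%:R ^- o)) //.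
  by apply: eq_bigr => x _; rewrite !fE.
rewrite -Keo.
have -> : ratr (bernoulli (p - K) / K%:R)
    = ratr (bernoulli (p - K)) / K%:R :> 'F_p.
  apply: reduces_ratr; apply: reducesM; first by apply: reduces_bernoulli => //; lia.
  by apply/reducesV/natr_Fp_neq0 => //; lia.
by rewrite -pmulrn -[RHS]mulr_natl mulrA -natrM.
Qed.

(** * From almost all primes to the quotient ring *)

Lemma prodFp_sumE (I : finType) (P : pred I) (a : I -> prodFp) (p : primeN) :
  (\sum_(i | P i) a i) p = \sum_(i | P i) a i p.
Proof. by apply: (big_morph (fun a : prodFp => a p)). Qed.

Lemma prodFp_mulrzE (a : prodFp) (z : int) (p : primeN) : (a *~ z) p = a p *~ z.
Proof.
have natE (b : prodFp) m : (b *+ m) p = b p *+ m.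
  by elim: m => [|m IH]; rewrite ?mulr0n // !mulrS -IH.
case: z => m; first by rewrite -!pmulrn natE.
by rewrite NegzE !mulrNz -!pmulrn -natE.
Qed.

Lemma prodFp_signE (m : nat) (a : prodFp) (p : primeN) :
  ((-1) ^+ m * a) p = (-1) ^+ m * a p.
Proof.
rewrite -signr_odd -[in RHS]signr_odd; case: (odd m); last by rewrite !mul1r.
by rewrite !expr1 !mulN1r.
Qed.

(** There are finitely many primes up to N. *)
Lemma eq_toA (a b : prodFp) (N : nat) :
  (forall p : primeN, (N < val p)%N -> a p = b p) -> toA a = toA b.
Proof.
move=> ab; apply/toA_eqP.
apply: (@cardinality.sub_finite_set _ _
  (classical_sets.preimage val (classical_sets.mkset (fun m : nat => (m < N.+1)%N)))).
  by move=> p; apply: contraR; rewrite -leqNgt => Np; apply/eqP/ab.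
apply: cardinality.finite_preimage; last exact: cardinality.finite_II.
by move=> p q _ _; apply: val_inj.
Qed.

(* Here r = n + 1, and k_1, ..., k_r are [k ord0], ..., [k ord_max].  The
   1-based position sigma^-1(r) is [((s^-1)%g ord_max).+1], and
   [lift_perm ord_max ord_max] extends tau in Sigma_(r-1) to Sigma_r by fixing r. *)
Theorem theorem3p6 (n : nat) (k : 'I_n.+1 -> nat)
    (k_gt0 : forall i : 'I_n.+1, (0 < k i)%N)
    (k_even : forall i : 'I_n.+1, (i < n)%N -> ~~ odd (k i))
    (k_odd : odd (k ord_max)) :
  \sum_(s : 'S_n.+1)
     zetaA2 (fun i => k (s i))
       *~ ((n.+1)%:Z + 1 - 2 * (((s^-1)%g ord_max).+1)%:Z)
  = (-1) ^+ n.+1 *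
    (ZA (\sum_(i < n.+1) k i)%N
       *~ \sum_(t : 'S_n) Ccoef (fun i => k (lift_perm ord_max ord_max t i))).
Proof.
(* For r = 1 both sides vanish: the weight 2 - 2 * 1 is 0, and C is an empty sum. *)
case: n k k_gt0 k_even k_odd => [|n] k k_gt0 k_even k_odd.
  rewrite [X in _ * (_ *~ X)]big1 ?mulr0z ?mulr0; last by move=> t _; rewrite /Ccoef big_geq.
  by apply: big1 => s _; rewrite ord1.
set K := (\sum_i k i)%N; set z := \sum_(t : 'S_n.+1) _.
pose w (s : 'S_n.+2) : int := (n.+2)%:Z + 1 - 2 * (((s^-1)%g ord_max).+1)%:Z.
pose zeta (s : 'S_n.+2) : prodFp := fun p => zeta_half (val p) (fun i => k (s i)).
pose bern : prodFp := fun p => ratr (bernoulli (val p - K) / K%:R).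
transitivity (toA (\sum_s zeta s *~ w s)).
  by rewrite /toA rmorph_sum; apply: eq_bigr => s _; rewrite rmorphMz.
transitivity (toA ((-1) ^+ n.+2 * (bern *~ z))); last first.
  by rewrite /toA rmorphM rmorph_sign rmorphMz.
apply: (@eq_toA _ _ K.+1) => p Kp.
rewrite prodFp_sumE prodFp_signE prodFp_mulrzE.
under eq_bigr do rewrite prodFp_mulrzE.
by apply: theorem_Fp => //; [exact: valP | lia].
Qed.
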